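(* Consider the difference equations system $x(n+1)=T(x(n))$, $n\in\mathbb{N}$, where $T:\mathbb{R}^m\to\mathbb{R}^m$ is continuous on some set $G\subset\mathbb{R}^m$. Suppose there exists a map $V:\mathbb{R}^m\to\mathbb{R}$ satisfying: (i) $V(x)$ is continuous at any $x\in G$; (ii) $V(T(x))-V(x)\le 0$ for any $x\in G$. For any $x_0\in G$, if there exist a compact set $G_c$ and $N\in\mathbb{N}$ such that the solution $x(n)$ to the system with $x(0)=x_0$ satisfies $x(n)\in G_c$ for any $n\ge N$, then there exists $c\in\mathbb{R}$ such that $x(n)\to M\cap V^{-1}(c)$ as $n\to\infty$, where $V^{-1}(c)=\{x\in\mathbb{R}^m\mid V(x)=c\}$ and $M$ is the largest invariant set in $E=\{x\in G_c\mid V(T(x))-V(x)=0\}$.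
   Context: $\mathbb{N}=\{0,1,2,\dots\}$; $\subset$ denotes not necessarily strict inclusion. The solution with $x(0)=x_0$ is the sequence $x(n)=T^n(x_0)$, $n\in\mathbb{N}$. For $x\in\mathbb{R}^m$ and $S\subset\mathbb{R}^m$, $\rho(x,S)=\inf_{y\in S}\|x-y\|$ for some norm on $\mathbb{R}^m$; $x(n)\to S$ as $n\to\infty$ means $\lim_{n\to\infty}\rho(x(n),S)=0$. For $H\subset\mathbb{R}^m$, $T(H)=\{y\in\mathbb{R}^m\mid y=T(x)\text{ for some }x\in H\}$, and $H$ is invariant if $T(H)=H$. A set $M$ is the largest invariant set in $E\subset\mathbb{R}^m$ if $M\subset E$, $T(M)=M$, and $T(A\cup M)\ne A\cup M$ for every non-empty set $A\subset E$ with $A\cap M=\emptyset$.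
   Formalization: The compact set G_c is additionally assumed to be contained in G; without this the claim fails, e.g. m=1, T(x)=-x, V(x)=x, G={1}, x_0=1, G_c={-1,1}, where E and M are empty. *)

(* Defs.v *)
From HB Require Import structures.
From mathcomp Require Import all_boot all_order all_algebra.
From mathcomp Require Import all_classical all_reals all_analysis.
Import Order.TTheory GRing.Theory Num.Theory numFieldNormedType.Exports.

Set Implicit Arguments.
Unset Strict Implicit.
Unset Printing Implicit Defensive.

Local Open Scope classical_set_scope.
Local Open Scope ring_scope.

Definition is_norm (R : realType) (m : nat) (nu : 'rV[R]_m -> R) : Prop :=
  [/\ forall x y, nu (x + y) <= nu x + nu y,
      forall (a : R) x, nu (a *: x) = `|a| * nu x
    & forall x, nu x = 0 -> x = 0].

(* The infimum is taken in the extended reals, so that the distance to the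
   empty set is +oo: with the convention inf set0 = 0 of the reals, every
   sequence would tend to the empty set. *)
Definition dist_to (R : realType) (m : nat) (nu : 'rV[R]_m -> R)
    (x : 'rV[R]_m) (S : set 'rV[R]_m) : \bar R :=
  ereal_inf [set (nu (x - y))%:E | y in S].

Definition tends_to_set (R : realType) (m : nat) (nu : 'rV[R]_m -> R)
    (x : nat -> 'rV[R]_m) (S : set 'rV[R]_m) : Prop :=
  dist_to nu (x n) S @[n --> \oo] --> 0%E.

Definition invariant_set (X : Type) (T : X -> X) (H : set X) : Prop :=
  T @` H = H.

Definition largest_invariant (X : Type) (T : X -> X) (E M : set X) : Prop :=
  [/\ M `<=` E, invariant_set T M &
      forall A : set X, A `<=` E -> A !=set0 -> A `&` M = set0 ->
        ~ invariant_set T (A `|` M)].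

(* So quantifying universally over the sets M such that
   [largest_invariant T E M] is the same as naming that one set. *)
Lemma largest_invariant_exists_unique (X : Type) (T : X -> X) (E : set X) :
  exists! M, largest_invariant T E M.
Proof.
pose F := [set H : set X | H `<=` E /\ invariant_set T H].
have FU (H K : set X) : invariant_set T H -> invariant_set T K ->
    invariant_set T (H `|` K).
  by rewrite /invariant_set image_setU => -> ->.
exists (\bigcup_(H in F) H); split.
  have IM : invariant_set T (\bigcup_(H in F) H).
    apply/seteqP; split=> [_ [x [H [HE HI] Hx] <-]|y [H [HE HI] Hy]].
      by exists H => //; rewrite -HI; exists x.
    move: (Hy); rewrite -{1}HI => -[x Hx <-].
    by exists x => //; exists H.
  have ME : \bigcup_(H in F) H `<=` E by move=> x [H [HE _] /HE].
  split=> // A AE [a Aa] AM AI.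
  have : (A `&` \bigcup_(H in F) H) a.
    split=> //; exists (A `|` \bigcup_(H in F) H); last by left.
    by split=> // x [/AE|/ME].
  by rewrite AM.
move=> M [ME MI Mmax].
apply/seteqP; split=> [x [H [HE HI] Hx]|x Mx]; last by exists M.
apply: contrapT => nMx.
apply: (Mmax (H `\` M)) => [y [/HE]//|||].
- by exists x.
- by apply/seteqP; split=> y // [[_ ?]].
- by rewrite setDE setUIl setUC; rewrite (setUC (~` M)) setUCr setIT; apply: FU.
Qed.

(* Main.v *)
(* The omega-limit set L of the orbit is contained in Gc and, by compactness of
   Gc and continuity of T, satisfies T(L) = L.  Along the orbit V eventually
   decreases and has a limit point in V(Gc), hence converges to some c, so V = c
   on L.  Then V (T x) = c = V x on L, and maximality of M gives L included in
   the intersection of M and V^-1(c).  Every refinement of the orbit has a limit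
   in L by compactness, so its distance to this intersection tends to 0. *)
Require Import Defs.
From mathcomp Require Import all_boot all_order all_algebra.
From mathcomp Require Import all_classical all_reals all_analysis.
From mathcomp Require Import lra.
Import Order.TTheory GRing.Theory Num.Theory numFieldNormedType.Exports.
Local Open Scope classical_set_scope.
Local Open Scope ring_scope.

Set Implicit Arguments.
Unset Strict Implicit.

(* Sequential limit points phrased with filters finer than [\oo], so that in a
   compact set no extraction of subsequences is needed. *)
Definition omega_limit (X : topologicalType) (u : nat -> X) : set X :=
  [set p | exists F : set_system nat,
     [/\ ProperFilter F, \oo `<=` F & u @ F --> p]].

Lemma cluster_fmap (I : Type) (X : topologicalType) (F : set_system I)
    {FF : Filter F} (f : I -> X) (p : X) : cluster (f @ F) p ->
  exists H : set_system I, [/\ ProperFilter H, F `<=` H & f @ H --> p].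
Proof.
move=> clp.
exists (filter_from [set AB : set X * set I | nbhs p AB.1 /\ F AB.2]
          (fun AB => f @^-1` AB.1 `&` AB.2)); split.
- apply: filter_from_proper.
    apply: filter_from_filter.
      by exists (setT, setT); split; exact: filterT.
    move=> [A B] [A' B'] [/= pA FB] [/= pA' FB'].
    exists (A `&` A', B `&` B'); first by split; exact: filterI.
    by move=> i /= [[? ?] [? ?]].
  move=> [A B] [/= pA FB].
  have [y [[i Bi <-] Afi]] : (f @` B) `&` A !=set0.
    by apply: clp => //; apply: (@filterS _ F _ B) => // i Bi; exists i.
  by exists i; split.
- move=> B FB; exists (setT, B); first by split=> //; exact: filterT.
  by move=> i [].
- move=> A pA; exists (A, setT); first by split=> //; exact: filterT.
  by move=> i [].
Qed.

Lemma compact_fmap (I : Type) (X : topologicalType) (K : set X)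
    (F : set_system I) {FF : ProperFilter F} (f : I -> X) :
    compact K -> (\forall i \near F, K (f i)) ->
  exists p : X, K p /\
    exists H : set_system I, [/\ ProperFilter H, F `<=` H & f @ H --> p].
Proof.
move=> cK FK; have [p [Kp clp]] := cK (f @ F) _ FK.
by exists p; split=> //; exact: cluster_fmap.
Qed.

(** Filter form of the sub-subsequence criterion. If the preimage of a neighbourhood of [l] were not
    in [F], then [F] restricted to the complement of that preimage would be proper, and no
    refinement of it could send [f] to [l]. *)
Lemma cvg_refinement (I : Type) (X : topologicalType) (F : set_system I)
    {FF : Filter F} (f : I -> X) (l : X) :
    (forall H : set_system I, ProperFilter H -> F `<=` H ->
       exists H' : set_system I,
         [/\ ProperFilter H', H `<=` H' & f @ H' --> l]) ->
  f @ F --> l.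
Proof.
move=> sub A lA; apply: contrapT => nFA.
pose H := within (~` (f @^-1` A)) F.
have PH : ProperFilter H.
  split; last exact: within_filter.
  move=> H0; apply: nFA; apply: (@filterS _ F _ _ _ _ H0) => i nA.
  exact: contrapT.
have FH : F `<=` H by move=> B FB; apply: filterS FB => i.
have [H' [PH' HH' fl]] := sub H PH FH.
apply: (@filter_not_empty _ H').
have H'A : H' (~` (f @^-1` A)) by apply: HH'; exact: (@filterE _ F).
have H'fA : H' (f @^-1` A) := fl A lA.
by rewrite -(setICl (f @^-1` A)); exact: filterI.
Qed.

Lemma within_continuous_cvg (I : Type) (X Y : topologicalType) (K : set X)
    (g : X -> Y) (F : set_system I) {FF : Filter F} (f : I -> X) (p : X) :
    {within K, continuous g} -> K p -> (\forall i \near F, K (f i)) ->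
  f @ F --> p -> g (f i) @[i --> F] --> g p.
Proof.
move=> /subspace_continuousP cg Kp FK fp A gA.
have /fp FA := cg p Kp A gA.
by apply: filterS (filterI FK FA) => i [Ki]; apply.
Qed.

Section orbit.
Context (X : topologicalType) (T : X -> X) (K : set X) (x0 : X).
Hypotheses (hX : hausdorff_space X) (cK : compact K)
  (cT : {within K, continuous T}).
Let u n := iter n T x0.
Hypothesis (uK : \forall n \near \oo, K (u n)).

Lemma omega_limit_sub : omega_limit u `<=` K.
Proof.
move=> p [F [PF Foo up]].
have FK : \forall n \near F, K (u n) := Foo _ uK.
exact: (closed_cvg K (compact_closed hX cK) FK _ up).
Qed.

Lemma omega_limit_invariant : invariant_set T (omega_limit u).
Proof.
apply/seteqP; split=> [_ [p Lp <-]|p [F [PF Foo up]]].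
  have Kp := omega_limit_sub Lp.
  case: Lp => F [PF Foo up].
  (* Since [u n.+1] is [T (u n)], following [u] along the shifted filter amounts to following [T] of
     [u] along [F]. *)
  exists (succn @ F); split; first exact: fmap_proper_filter.
    by move=> A [n _ nA]; apply: Foo; exists n => // k /= nk; apply/nA/leqW.
  have FK : \forall n \near F, K (u n) := Foo _ uK.
  exact: (within_continuous_cvg cT Kp FK up).
(* A limit [q] of [u] along a refinement of the shifted filter is a preimage
   of [p], since [T (u n.-1) = u n] for [n > 0]. *)
have PP : ProperFilter (predn @ F) by exact: fmap_proper_filter.
have Poo : \oo `<=` predn @ F.
  move=> A [n _ nA]; apply: Foo; exists n.+1 => // k /= nk; apply: nA => /=.
  by rewrite -ltnS (ltn_predK nk).
have PK : \forall n \near predn @ F, K (u n) := Poo _ uK.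
have [q [Kq [H [PH PFH uq]]]] := compact_fmap cK PK.
exists q; first by exists H; split=> //; exact: subset_trans PFH.
have Hoo : \oo `<=` H by exact: subset_trans PFH.
have HK : \forall n \near H, K (u n) := PFH _ PK.
have Tuq : T (u i) @[i --> H] --> T q.
  exact: (within_continuous_cvg cT Kq HK uq).
have Tup : T (u i) @[i --> H] --> p.
  move=> A /up FA; apply: PFH.
  have F0 : F [set n | (0 < n)%N] by apply: Foo; exists 1%N.
  have FA' : F (u @^-1` A) := FA.
  by apply: (@filterS _ F _ _ _ _ (filterI F0 FA')) => -[|n] [].
exact: (cvg_unique hX Tuq Tup).
Qed.

End orbit.

(** Otherwise [H]\[M] is a non-empty subset of [E] disjoint from [M], and its union with [M] is
    [H]|[M], invariant as a union of invariant sets. *)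
Lemma largest_invariant_max (X : Type) (T : X -> X) (E M H : set X) :
  largest_invariant T E M -> H `<=` E -> invariant_set T H -> H `<=` M.
Proof.
move=> [_ MI Mmax] HE HI x Hx; apply: contrapT => nMx.
apply: (Mmax (H `\` M)) => [y [/HE]//|||].
- by exists x.
- by apply/seteqP; split=> y // [[_ ?]].
- rewrite setDE setUIl setUC (setUC (~` M)) setUCr setIT setUC.
  by rewrite /invariant_set image_setU HI MI.
Qed.

(** The triangle inequality for [x] and [- x] gives [0 = nu 0 <= 2 * nu x]. *)
Lemma is_norm_ge0 (R : realType) (m : nat) (nu : 'rV[R]_m -> R) :
  is_norm nu -> forall x, 0 <= nu x.
Proof.
move=> [nuD nuZ _] x; have := nuD x ((-1) *: x).
rewrite nuZ normrN1 mul1r scaleN1r subrr.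
have -> : nu 0 = 0 by rewrite -(scale0r x) nuZ normr0 mul0r.
by move=> ?; lra.
Qed.

(** One half of the equivalence of norms in finite dimension: expanding [x] in the canonical basis
    bounds [nu] by a weighted sum [g] of the absolute values of the coordinates, and each coordinate
    tends to 0. *)
Lemma is_norm_cvg0 (R : realType) (m : nat) (nu : 'rV[R]_m -> R)
    (I : Type) (F : set_system I) {FF : Filter F} (f : I -> 'rV[R]_m) :
  is_norm nu -> f @ F --> (0 : 'rV[R]_m) -> nu (f i) @[i --> F] --> (0 : R).
Proof.
move=> nu_norm f0; have nu_ge0 := is_norm_ge0 nu_norm.
case: nu_norm => nuD nuZ _.
have nu0 : nu 0 = 0 by rewrite -(scale0r 0) nuZ normr0 mul0r.
pose g (x : 'rV[R]_m) := \sum_(j < m) `|x ord0 j| * nu (delta_mx ord0 j).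
have nug x : nu x <= g x.
  rewrite {1}[x]row_sum_delta /g.
  elim/big_ind2: _ => [|a b c d ab cd|j _]; first by rewrite nu0.
    exact: le_trans (nuD _ _) (lerD ab cd).
  by rewrite nuZ.
have gf0 : g (f i) @[i --> F] --> 0.
  have <- : \sum_(j < m) (0 : R) = 0 by rewrite big1.
  apply: cvg_big => [|j _]; first exact: add_continuous.
  rewrite -[X in _ --> X](mul0r (nu (delta_mx ord0 j))); apply: cvgMr_tmp.
  rewrite -(normr0 R); apply: cvg_norm.
  have := cvg_comp _ _ f0 (@coord_continuous _ _ _ ord0 j 0).
  by rewrite mxE.
apply: squeeze_cvgr gf0 => //; last exact: cvg_cst.
by apply: nearW => i; rewrite nu_ge0 nug.
Qed.

(** The distance to [S] lies between 0 and [nu (x n - q)], because [q] is itself a point of [S]. *)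
Lemma cvg_tends_to_set (R : realType) (m : nat) (nu : 'rV[R]_m -> R)
    (x : nat -> 'rV[R]_m) (S : set 'rV[R]_m) (F : set_system nat)
    {FF : Filter F} (q : 'rV[R]_m) :
  is_norm nu -> S q -> x @ F --> q -> dist_to nu (x n) S @[n --> F] --> 0%E.
Proof.
move=> nu_norm Sq xq.
apply: (@squeeze_cvge _ _ _ _ (cst 0%E) _ (fun n => (nu (x n - q))%:E)).
- apply: nearW => n; apply/andP; split.
    apply: le_ereal_inf_tmp => _ [y _ <-]; rewrite lee_fin; exact: is_norm_ge0.
  by apply: ereal_inf_lbound; exists q.
- exact: cvg_cst.
- apply: cvg_EFin; first exact: nearW.
  apply: is_norm_cvg0 nu_norm _.
  by rewrite -(subrr q); apply: cvgB => //; exact: cvg_cst.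
Qed.

Lemma lyapunov_cvg (R : realType) (X : topologicalType) (K : set X)
    (u : nat -> X) (V : X -> R) (N : nat) :
    compact K -> (forall n, (N <= n)%N -> K (u n)) ->
    (forall x, K x -> {for x, continuous V}) ->
    (forall n, (N <= n)%N -> V (u n.+1) <= V (u n)) ->
  exists c : R, V (u n) @[n --> \oo] --> c.
Proof.
move=> cK uK Vc Vd.
have Vmon n k : (N <= n <= k)%N -> V (u k) <= V (u n).
  move=> /andP[Nn nk]; rewrite -(subnK nk); elim: (k - n)%N => // d IH.
  by apply: le_trans IH; rewrite addSn; apply: Vd; rewrite (leq_trans Nn) ?leq_addl.
have [|p [Kp [F [PF Foo up]]]] := compact_fmap (F := \oo) (f := u) cK.
  by exists N.
have VF : V (u n) @[n --> F] --> V p by exact: (cvg_comp _ _ up (Vc p Kp)).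
suff /cvg_ex[c] : cvgn (V \o u) by exists c.
apply: (@near_nonincreasing_is_cvgn _ _ (V p)).
  by exists N => // n /= Nn k nk; apply: Vmon; rewrite Nn.
(* [V p] is a lower bound: for fixed [n], the values [V (u k)] stay below [V (u n)] for large [k],
   and they tend to [V p] along [F]. *)
exists N => // n /= Nn; apply: (cvgr_to_le VF).
by apply: Foo; exists n => // k /= nk; apply: Vmon; rewrite Nn.
Qed.

Unset Implicit Arguments.
Set Strict Implicit.

Theorem theorem2 (R : realType) (m : nat)
  (nu : 'rV[R]_m -> R) (nu_norm : is_norm nu)
  (T : 'rV[R]_m -> 'rV[R]_m) (G : set 'rV[R]_m)
  (T_cont : {within G, continuous T})
  (V : 'rV[R]_m -> R)
  (V_cont : forall x, G x -> {for x, continuous V})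
  (V_decr : forall x, G x -> V (T x) - V x <= 0)
  (x0 : 'rV[R]_m) (x0G : G x0)
  (Gc : set 'rV[R]_m) (Gc_compact : compact Gc) (Gc_sub : Gc `<=` G)
  (N : nat) (orbit_Gc : forall n, (N <= n)%N -> Gc (iter n T x0))
  (M : set 'rV[R]_m)
  (M_largest : largest_invariant T [set x | Gc x /\ V (T x) - V x = 0] M) :
  exists c : R,
    tends_to_set nu (fun n => iter n T x0) (M `&` [set x | V x = c]).
Proof.
pose u n := iter n T x0.
have uGc : \forall n \near \oo, Gc (u n) by exists N.
have T_cont_Gc := continuous_subspaceW Gc_sub T_cont.
have hX : hausdorff_space 'rV[R]_m by exact: norm_hausdorff.
have [|n Nn|c Vuc] := @lyapunov_cvg R _ Gc u V N Gc_compact orbit_Gc.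
- by move=> x /Gc_sub; exact: V_cont.
- by rewrite -subr_le0; apply: V_decr; apply: Gc_sub; exact: orbit_Gc.
have LGc := omega_limit_sub hX Gc_compact uGc.
have LI := omega_limit_invariant hX Gc_compact T_cont_Gc uGc.
have LV p : omega_limit u p -> V p = c.
  move=> Lp; have /Gc_sub/V_cont Vp := LGc _ Lp.
  case: Lp => F [PF Foo up].
  have VFp : V (u n) @[n --> F] --> V p := cvg_comp _ _ up Vp.
  have VFc : V (u n) @[n --> F] --> c by move=> A /Vuc /Foo.
  exact: (cvg_unique (@norm_hausdorff R R^o) VFp VFc).
have LM : omega_limit u `<=` M.
  apply: (largest_invariant_max M_largest _ LI) => p Lp.
  split; first exact: LGc.
  (* By [LI], [T p] is again an omega-limit point, so [V] takes the value [c] at both [p] and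
     [T p]. *)
  by rewrite !LV ?subrr // -LI; exists p.
(* The criterion is applied to the distances rather than to the orbit: the limit point [q] may
   change with the refinement [H], whereas the limit distance is always 0. *)
exists c; apply: cvg_refinement => H PH Hoo.
have [q [_ [F [PF HF uq]]]] := compact_fmap Gc_compact (Hoo _ uGc).
have Lq : omega_limit u q by exists F; split=> //; exact: subset_trans HF.
exists F; split=> //; apply: (cvg_tends_to_set nu_norm _ uq).
by split; [exact: LM | exact: LV].
Qed.
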